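(* Let $\mathcal{H}$ be a real Hilbert space with $\dim(\mathcal{H})\ge 2$. Then for any $\kappa,\tau>0$, $$\mathcal{T}_2(\kappa,\tau,\mathcal{H})=\sqrt{\kappa^2+\tau^2}.$$
   Context: For a real Banach space $\mathcal{X}$ with unit sphere $S_{\mathcal{X}}$ and $\kappa,\tau>0$, $$\mathcal{T}_2(\kappa,\tau,\mathcal{X})=\sup_{x_1,x_2\in S_{\mathcal{X}}}\big(\|\kappa x_1+\tau x_2\|\,\|\tau x_1-\kappa x_2\|\big)^{1/2}.$$ *)

(* Defs.v *)
From mathcomp Require Import all_boot all_order all_algebra.
From mathcomp Require Import all_classical all_reals all_analysis.

Set Implicit Arguments.
Unset Strict Implicit.
Unset Printing Implicit Defensive.

Import Order.TTheory GRing.Theory Num.Theory.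
Import numFieldNormedType.Exports.

Local Open Scope classical_set_scope.
Local Open Scope ring_scope.

Definition unit_sphere (R : realType) (X : normedModType R) : set X :=
  [set x | `|x| = 1].

(* On a nonzero space the set below is nonempty and bounded above by
   kappa + tau, so that the default value of [sup] is not used. *)
Definition T2 (R : realType) (kappa tau : R) (X : completeNormedModType R) : R :=
  sup [set r : R | exists x1 x2 : X,
        [/\ unit_sphere x1, unit_sphere x2 &
            r = Num.sqrt (`|kappa *: x1 + tau *: x2| *
                          `|tau *: x1 - kappa *: x2|)]].

(* The complete norm of [H] comes from an inner product, that is, from a
   positive definite symmetric bilinear form. *)
Definition is_hilbert (R : realType) (H : completeNormedModType R) : Prop :=
  exists dot : {dot H for @idfun R}, forall x : H, `|x| = Num.sqrt (dot x x).

Definition lin_indep (R : realType) (V : lmodType R) (n : nat) (v : 'I_n -> V) :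
    Prop :=
  forall a : 'I_n -> R, \sum_(i < n) a i *: v i = 0 -> forall i, a i = 0.

(* [n <= dim V], where [V] may be infinite-dimensional. *)
Definition dim_ge (R : realType) (n : nat) (V : lmodType R) : Prop :=
  exists v : 'I_n -> V, lin_indep v.

(* Main.v *)
Require Import Defs.
From mathcomp Require Import all_boot all_order all_algebra.
From mathcomp Require Import all_classical all_reals all_analysis.
From mathcomp Require Import ring lra.
Import Order.TTheory GRing.Theory Num.Theory.
Import numFieldNormedType.Exports.
Local Open Scope ring_scope.

(** Expanding the inner product, the vectors [kappa x1 + tau x2] and
    [tau x1 - kappa x2] have squared norms
    [kappa^2 + tau^2 + 2 kappa tau <x1, x2>] and
    [kappa^2 + tau^2 - 2 kappa tau <x1, x2>] when [x1] and [x2] are unit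
    vectors ([sqr_norm_combD], [sqr_norm_combB]).  The cross terms cancel in
    the sum of the two, so the arithmetic-geometric mean inequality bounds the
    product of the norms by [kappa^2 + tau^2].  When [x1] and [x2] are
    orthogonal both norms are equal to [sqrt (kappa^2 + tau^2)] and the bound
    is attained; a space of dimension at least 2 contains such a pair by one
    Gram-Schmidt step ([orthonormal_pair]). *)

Lemma form_comb (R : comNzRingType) (U : lmodType R) (f : {symmetric U})
    (a b : R) (x y : U) :
  f (a *: x + b *: y) (a *: x + b *: y) =
  a ^+ 2 * f x x + 2 * (a * b) * f x y + b ^+ 2 * f y y.
Proof.
have fC : f y x = f x y by rewrite hermC /= expr0 mul1r.
by rewrite linearDl !linearDr /= !linearZl_LR !linearZr_LR /= fC; ring.
Qed.

Section InnerProduct.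
Context {R : realType} {H : normedModType R} (dot : {dot H for @idfun R}).

(** Gram-Schmidt: of two independent vectors, the second minus its projection on
    the first is orthogonal to the first, and nonzero by independence. *)
Lemma orthonormal_pair : dim_ge 2 H ->
  exists x y : H, [/\ `|x| = 1, `|y| = 1 & dot x y = 0].
Proof.
move=> [v v_free]; set u := v ord0; set w := v ord_max.
have free2 (a b : R) : a *: u + b *: w = 0 -> a = 0 /\ b = 0.
  move=> comb0; pose c (i : 'I_2) := if i == ord0 then a else b.
  have c0 : forall i, c i = 0.
    apply: v_free; rewrite big_ord_recl big_ord1 /c /=.
    by rewrite (_ : lift ord0 ord0 = ord_max) //; apply: val_inj.
  by split; [exact: (c0 ord0) | exact: (c0 ord_max)].
have u_neq0 : u != 0.
  apply/eqP => u0; have [] := free2 1 0; first by rewrite u0 scaler0 scale0r addr0.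
  by move/eqP; rewrite oner_eq0.
(* The combination [<u, u> w - <w, u> u] is the usual Gram-Schmidt vector,
   scaled by [<u, u>] to avoid a division. *)
pose z := - dot w u *: u + dot u u *: w.
have uu_gt0 : 0 < dot u u by exact: neq0_dnorm_gt0.
have z_neq0 : z != 0.
  by apply/eqP => /free2[_ uu0]; rewrite uu0 ltxx in uu_gt0.
have dotC : dot w u = dot u w by rewrite hermC /= expr0 mul1r.
have uz : dot u z = 0 by rewrite linearDr /= !linearZr_LR /= dotC; ring.
exists (`|u|^-1 *: u), (`|z|^-1 *: z); split.
- by rewrite normrZ normfV normr_id mulVf ?normr_eq0.
- by rewrite normrZ normfV normr_id mulVf ?normr_eq0.
- by rewrite linearZr_LR linearZl_LR /= uz !mulr0.
Qed.

Context (norm_dot : forall x : H, `|x| = Num.sqrt (dot x x)).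

Lemma sqr_norm_dot (x : H) : `|x| ^+ 2 = dot x x.
Proof.
rewrite norm_dot sqr_sqrtr //.
have [->|x_neq0] := eqVneq x 0; first by rewrite linear0l.
exact/ltW/neq0_dnorm_gt0.
Qed.

Lemma sqr_norm_combD (a b : R) (x y : H) : `|x| = 1 -> `|y| = 1 ->
  `|a *: x + b *: y| ^+ 2 = a ^+ 2 + b ^+ 2 + 2 * (a * b) * dot x y.
Proof.
move=> x1 y1; rewrite sqr_norm_dot form_comb /= -!sqr_norm_dot x1 y1; ring.
Qed.

Lemma sqr_norm_combB (a b : R) (x y : H) : `|x| = 1 -> `|y| = 1 ->
  `|b *: x - a *: y| ^+ 2 = a ^+ 2 + b ^+ 2 - 2 * (a * b) * dot x y.
Proof. by move=> x1 y1; rewrite -scaleNr sqr_norm_combD //; ring. Qed.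

End InnerProduct.

Theorem lemma7 (R : realType) (H : completeNormedModType R)
    (hilbH : is_hilbert H) (dimH : dim_ge 2 H)
    (kappa tau : R) (kappa_gt0 : 0 < kappa) (tau_gt0 : 0 < tau) :
  T2 kappa tau H = Num.sqrt (kappa ^+ 2 + tau ^+ 2).
Proof.
have [dot norm_dot] := hilbH.
have [e1 [e2 [e1_unit e2_unit e12]]] := orthonormal_pair dot dimH.
rewrite /T2; set E := (X in sup X).
have E_ub : ubound E (Num.sqrt (kappa ^+ 2 + tau ^+ 2)).
  move=> _ [x [y [x_unit y_unit ->]]]; apply: ler_wsqrtr.
  have := sqr_norm_combD dot norm_dot kappa tau _ _ x_unit y_unit.
  have := sqr_norm_combB dot norm_dot kappa tau _ _ x_unit y_unit.
  set p := `|_ - _|; set q := `|_ + _| => p2 q2.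
  have := sqr_ge0 (p - q); rewrite sqrrB p2 q2; lra.
have E_max : E (Num.sqrt (kappa ^+ 2 + tau ^+ 2)).
  exists e1, e2; split=> //; congr Num.sqrt.
  have := sqr_norm_combD dot norm_dot kappa tau _ _ e1_unit e2_unit.
  have := sqr_norm_combB dot norm_dot kappa tau _ _ e1_unit e2_unit.
  rewrite e12 mulr0 subr0 addr0 => p2 q2.
  have /eqP pq : `|kappa *: e1 + tau *: e2| == `|tau *: e1 - kappa *: e2|.
    by rewrite -(eqrXn2 (n := 2)) // p2 q2.
  by rewrite pq -expr2 p2.
apply/eqP; rewrite eq_le; apply/andP; split.
- by apply: ge_sup => //; exists (Num.sqrt (kappa ^+ 2 + tau ^+ 2)).
- by apply: ub_le_sup => //; exists (Num.sqrt (kappa ^+ 2 + tau ^+ 2)).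
Qed.
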